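(* Let $\mathcal{E}$ be a finite-dimensional Euclidean space, let $\alpha\in(0,\infty)$, let $y\in\mathcal{E}$, and let $S\subseteq\mathcal{E}$ be a closed convex set with $0\in\mathrm{int}\,S$. (i) If $\gamma_S(y)\neq 0$ and, at the point $\bar y=y/\gamma_S(y)$, the set $S$ is (locally) $\alpha$-strongly convex w.r.t. $(\bar y,\zeta)$ for some unit normal vector $\zeta\in N_S(\bar y)$, then $\frac12\gamma_S^2$ is (locally) strongly convex with parameter $$\frac{1}{2(\zeta^T\bar y)^3}\left(\zeta^T\bar y+\alpha\|\bar y\|^2-\sqrt{(\zeta^T\bar y+\alpha\|\bar y\|^2)^2-4\alpha(\zeta^T\bar y)^3}\right)$$ w.r.t. $(y,g)$, where $g=\frac{\gamma_S(y)\zeta}{\zeta^T\bar y}\in\partial(\frac12\gamma_S^2)(y)$. (ii) If $\gamma_S(y)=0$ and $y=0$, then $\partial(\frac12\gamma_S^2)(y)=\{0\}$ and $\frac12\gamma_S^2$ is (locally) $\frac{1}{D(S)^2}$-strongly convex w.r.t. $(0,0)$. (iii) If $\gamma_S(y)=0$ and $y\neq0$, then $\frac12\gamma_S^2$ is not strongly convex at $y$.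
   Context: $\|\cdot\|$ is the Euclidean norm and $B(x,r)$ the closed ball of center $x$ and radius $r$. The gauge of $S$ is $\gamma_S(x)=\inf\{\lambda>0\mid x\in\lambda S\}$. The normal cone at $x\in S$ is $N_S(x)=\{\zeta\mid \zeta^T(z-x)\le 0\ \forall z\in S\}$; $\partial h(x)=\{g\mid h(z)-h(x)\ge g^T(z-x)\ \forall z\}$. $D(S)=\sup\{\|x\|\mid x\in S\}\in(0,\infty]$, with $1/\infty=0$. Local strong convexity of a set: for $\bar y\in \mathrm{bdry}\,S$ and unit $\zeta\in N_S(\bar y)$, $S$ is (locally) $\alpha$-strongly convex w.r.t. $(\bar y,\zeta)$ if for every $0<\tilde\alpha<\alpha$ there is $\eta>0$ small enough that $S\cap B(\bar y,\eta)\subseteq B(\bar y-\frac1{\tilde\alpha}\zeta,\frac1{\tilde\alpha})\cap B(\bar y,\eta)$. Local strong convexity of a function: a closed convex function $h$ is (locally) $\mu$-strongly convex w.r.t. $(x,g)$, $g\in\partial h(x)$, if for every $\tilde\mu<\mu$ there is $\eta>0$ with $h(z)\ge h(x)+g^T(z-x)+\frac{\tilde\mu}{2}\|z-x\|^2$ for all $z\in B(x,\eta)$. ''Not strongly convex at $y$'' means it is not locally $\mu$-strongly convex w.r.t. $(y,g)$ for any $\mu>0$ and $g\in\partial h(y)$. *)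

(* Defs.v *)
From HB Require Import structures.
From mathcomp Require Import all_boot all_order all_algebra.
From mathcomp Require Import all_classical all_reals all_analysis.

Set Implicit Arguments.
Unset Strict Implicit.
Unset Printing Implicit Defensive.

Import Order.TTheory GRing.Theory Num.Theory.
Import numFieldNormedType.Exports.

Local Open Scope classical_set_scope.
Local Open Scope ring_scope.

(* The Euclidean space is 'cV[R]_n with the dot product u^T v. The norm that
   MathComp-Analysis puts on matrices, `|x|, is the sup norm, so the Euclidean
   norm and its closed balls are defined here. Topological notions (closed,
   interior, lower semicontinuity) are the library's: both norms induce the
   same topology. *)

Section EuclideanSpace.
Context {R : realType} {n : nat}.
Local Notation E := 'cV[R]_n.
Implicit Types (S : set E) (x y g u v zeta : E) (h : E -> R) (mu alpha : R).

Definition dot u v : R := (u^T *m v) ord0 ord0.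

Definition enorm x : R := Num.sqrt (dot x x).

Definition eball x (r : R) : set E := [set z | enorm (z - x) <= r].

Definition gauge S x : R :=
  inf [set l : R | 0 < l /\ ((fun s => l *: s) @` S) x].

Definition half_sq_gauge S x : R := 2^-1 * gauge S x ^+ 2.

Definition normal_cone S x : set E :=
  [set zeta | forall z, S z -> dot zeta (z - x) <= 0].

Definition subdifferential h x : set E :=
  [set g | forall z, dot g (z - x) <= h z - h x].

(* D(S), which is +oo when S is unbounded. *)
Definition outer_radius S : \bar R := ereal_sup [set (enorm x)%:E | x in S].

(* Lower semicontinuity is closedness of the epigraph. *)
Definition closed_convex_function h : Prop :=
  convex_function setT h /\ lower_semicontinuous (fun x => (h x)%:E).

(* Meaningful for ybar on the boundary of S and zeta a unit vector of
   [normal_cone S ybar]. *)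
Definition strongly_convex_set_at S alpha ybar zeta : Prop :=
  forall a : R, 0 < a -> a < alpha ->
    exists2 eta : R, 0 < eta &
      S `&` eball ybar eta `<=`
        eball (ybar - a^-1 *: zeta) a^-1 `&` eball ybar eta.

(* Meaningful for h a closed convex function and g in
   [subdifferential h x]. *)
Definition strongly_convex_function_at h mu x g : Prop :=
  forall m : R, m < mu ->
    exists2 eta : R, 0 < eta &
      forall z, eball x eta z ->
        h x + dot g (z - x) + m / 2 * enorm (z - x) ^+ 2 <= h z.

Definition not_strongly_convex_function_at h y : Prop :=
  forall mu g, 0 < mu -> subdifferential h y g ->
    ~ strongly_convex_function_at h mu y g.

End EuclideanSpace.

(* Main.v *)
(* Part (i) reduces by 2-homogeneity to gauge 1 at [ybar]. Near [ybar] write a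
   point as [t s] with [s] in [S] of gauge 1, and [s - ybar = e - delta zeta]
   with [e] orthogonal to [zeta]; curvature gives
   [delta >= alpha/2 |s - ybar|^2] up to an arbitrarily small loss in [alpha].
   The gain over the linear lower bound is
   [((t - 1)^2 + 2 t delta / a) / 2], and since the component of [s - ybar]
   along [zeta] only contributes [o(delta)] to [|t s - ybar|^2], the modulus is
   the smallest ratio of the two binary quadratic forms
   [tau^2 + (alpha/a) e^2] and [N tau^2 + 2 sqrt(N - a^2) tau e + e^2], where
   [N = |ybar|^2]: a root of [a^3 m^2 - (a + alpha N) m + alpha = 0]. *)
Require Import Defs.
From HB Require Import structures.
From mathcomp Require Import all_boot all_order all_algebra.
From mathcomp Require Import all_classical all_reals all_analysis.
From mathcomp Require Import ring lra.

Set Implicit Arguments.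
Unset Strict Implicit.
Unset Printing Implicit Defensive.

Import Order.TTheory GRing.Theory Num.Theory.
Import numFieldNormedType.Exports.

Local Open Scope classical_set_scope.
Local Open Scope ring_scope.

(** * Inner product and Euclidean norm, and comparison with the sup norm *)

Section Dot.
Context {R : realType} {n : nat}.
Implicit Types (u v w x y : 'cV[R]_n) (k t : R).

Lemma dotE u v : dot u v = \sum_i u i ord0 * v i ord0.
Proof. by rewrite /dot mxE; apply: eq_bigr => i _; rewrite mxE. Qed.

Lemma dotC u v : dot u v = dot v u.
Proof. by rewrite !dotE; apply: eq_bigr => i _; rewrite mulrC. Qed.

Lemma dotDl u v w : dot (u + v) w = dot u w + dot v w.
Proof. by rewrite /dot linearD mulmxDl mxE. Qed.

Lemma dotZl k u w : dot (k *: u) w = k * dot u w.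
Proof. by rewrite /dot linearZ -scalemxAl mxE. Qed.

Lemma dotDr u v w : dot w (u + v) = dot w u + dot w v.
Proof. by rewrite dotC dotDl !(dotC w). Qed.

Lemma dotZr k u w : dot w (k *: u) = k * dot w u.
Proof. by rewrite dotC dotZl dotC. Qed.

Lemma dotNl u w : dot (- u) w = - dot u w.
Proof. by rewrite -scaleN1r dotZl mulN1r. Qed.

Lemma dotNr u w : dot w (- u) = - dot w u.
Proof. by rewrite dotC dotNl dotC. Qed.

Lemma dot0l w : dot 0 w = 0.
Proof. by rewrite -(scale0r 0) dotZl mul0r. Qed.

Definition dot_lin := (dotDl, dotDr, dotNl, dotNr, dotZl, dotZr).

Lemma dot_ge0 u : 0 <= dot u u.
Proof. by rewrite dotE sumr_ge0 // => i _; rewrite -expr2 sqr_ge0. Qed.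

Lemma coord_sqr_le_dot u i : u i ord0 ^+ 2 <= dot u u.
Proof.
rewrite dotE (bigD1 i) //= -expr2 lerDl.
by rewrite sumr_ge0 // => j _; rewrite -expr2 sqr_ge0.
Qed.

Lemma dot_eq0 u : dot u u = 0 -> u = 0.
Proof.
move=> u0; apply/matrixP => i j; rewrite (ord1 j) mxE; apply/eqP.
by rewrite -sqrf_eq0 eq_le sqr_ge0 andbT -u0 coord_sqr_le_dot.
Qed.

(** The squared norm of [dot v v *: u - dot u v *: v] is [dot v v] times the gap of the
    inequality. *)
Lemma dot_cauchy_schwarz u v : dot u v ^+ 2 <= dot u u * dot v v.
Proof.
have := dot_ge0 (dot v v *: u - dot u v *: v).
rewrite !dot_lin (dotC v u); have := dot_ge0 v.
rewrite le_eqVlt => /predU1P[/esym/dot_eq0 ->|v0].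
  by move=> _; rewrite dotC !dot0l expr0n mulr0.
by move=> h; rewrite -subr_ge0 -(pmulr_rge0 _ v0); lra.
Qed.

Lemma enorm_sqr u : enorm u ^+ 2 = dot u u.
Proof. by rewrite sqr_sqrtr // dot_ge0. Qed.

Lemma enorm_ge0 u : 0 <= enorm u.
Proof. exact: sqrtr_ge0. Qed.

Lemma normr_dot_le u v : `|dot u v| <= enorm u * enorm v.
Proof.
rewrite -ler_sqr ?nnegrE ?mulr_ge0 ?enorm_ge0 //.
by rewrite exprMn !enorm_sqr real_normK ?num_real // dot_cauchy_schwarz.
Qed.

Lemma enormZ k u : enorm (k *: u) = `|k| * enorm u.
Proof. by rewrite /enorm !dot_lin mulrA -expr2 sqrtrM ?sqr_ge0 // sqrtr_sqr. Qed.

Lemma enormN u : enorm (- u) = enorm u.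
Proof. by rewrite -scaleN1r enormZ normrN1 mul1r. Qed.

Lemma enorm0 : enorm (0 : 'cV[R]_n) = 0.
Proof. by rewrite -(scale0r 0) enormZ normr0 mul0r. Qed.

Lemma ler_enormD u v : enorm (u + v) <= enorm u + enorm v.
Proof.
rewrite -ler_sqr ?nnegrE ?addr_ge0 ?enorm_ge0 //.
rewrite enorm_sqr !dot_lin sqrrD !enorm_sqr (dotC v u).
by have := ler_normlW (normr_dot_le u v); lra.
Qed.

Lemma coord_le_enorm u i : `|u i ord0| <= enorm u.
Proof. by rewrite -sqrtr_sqr ler_wsqrtr // coord_sqr_le_dot. Qed.

(** The crude factor [n.+1], in place of the square root of [n], stays positive in dimension 0, so
    it can be divided by. *)
Lemma enorm_le_coord u k : 0 <= k -> (forall i, `|u i ord0| <= k) ->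
  enorm u <= n.+1%:R * k.
Proof.
move=> k0 uk; rewrite -ler_sqr ?nnegrE ?mulr_ge0 ?enorm_ge0 // enorm_sqr.
apply: (@le_trans _ _ (n%:R * k ^+ 2)).
  rewrite dotE mulr_natl -[X in _ *+ X](card_ord n) -sumr_const.
  apply: ler_sum => i _; rewrite -expr2 -real_normK ?num_real //.
  by rewrite ler_sqr ?nnegrE.
rewrite exprMn ler_wpM2r ?sqr_ge0 // -natrX ler_nat.
by rewrite (leq_trans (leqnSn n)) // expnS leq_pmulr.
Qed.

Lemma nbhs_eball x (V : set 'cV[R]_n) : nbhs x V ->
  exists2 e : R, 0 < e & forall z, enorm (z - x) < e -> V z.
Proof.
move=> /nbhs_ballP[e /= e0 xV]; exists e => // z zx; apply: xV; split=> // i j.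
rewrite (ord1 j) /ball /= distrC; apply: le_lt_trans zx.
by have := coord_le_enorm (z - x) i; rewrite !mxE.
Qed.

End Dot.

(** * Scalar inequalities behind the modulus *)

Section StrongConvexityArithmetic.
Context {R : realType}.
Implicit Types (a b m N W : R).

(* The stated modulus is the smaller root of
   [a^3 m^2 - (a + alpha N) m + alpha = 0]. *)
Lemma modulus_root a alpha N m :
  0 < a -> 0 < alpha -> a ^+ 2 <= N ->
  let b := a + alpha * N in
  m < (2 * a ^+ 3)^-1 * (b - Num.sqrt (b ^+ 2 - 4 * alpha * a ^+ 3)) ->
  m * N < 1 /\ 0 < a ^+ 3 * m ^+ 2 - b * m + alpha.
Proof.
move=> a0 al0 aN b mlt.
have a3 : 0 < a ^+ 3 by rewrite exprn_gt0.
have N0 : 0 < N by apply: lt_le_trans aN; rewrite exprn_gt0.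
(* The discriminant equals [(a - alpha * N) ^+ 2 + 4 * alpha * a * (N - a ^+ 2)]. *)
have disc0 : 0 <= b ^+ 2 - 4 * alpha * a ^+ 3.
  have : 0 <= (a - alpha * N) ^+ 2 by rewrite sqr_ge0.
  have : 0 <= alpha * a * (N - a ^+ 2).
    by rewrite !mulr_ge0 ?subr_ge0 // ltW.
  by rewrite /b; lra.
have s0 := sqrtr_ge0 (b ^+ 2 - 4 * alpha * a ^+ 3).
have sE := sqr_sqrtr disc0.
move: mlt; set s := Num.sqrt _ in s0 sE *.
rewrite mulrC ltr_pdivlMr ?mulr_gt0 // => mlt.
have P0 : 0 < a ^+ 3 * m ^+ 2 - b * m + alpha.
  have : s ^+ 2 < (b - 2 * a ^+ 3 * m) ^+ 2.
    by rewrite ltr_sqr ?nnegrE //; lra.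
  rewrite sE -subr_gt0.
  have -> : (b - 2 * a ^+ 3 * m) ^+ 2 - (b ^+ 2 - 4 * alpha * a ^+ 3) =
    4 * a ^+ 3 * (a ^+ 3 * m ^+ 2 - b * m + alpha) by ring.
  by rewrite pmulr_rgt0 ?mulr_gt0.
(* At [1 / N] the quadratic has value [- a * (N - a ^+ 2) / N ^+ 2 <= 0], so [1 / N] lies between
   the roots and cannot be at most [m]. The product below is [N ^+ 2] times the value at [1 / N]
   minus the value at [m]. *)
split=> //; rewrite ltNge; apply/negP => mN.
have : 0 <= (m * N - 1) * (b * N - a ^+ 3 * (m * N + 1)).
  apply: mulr_ge0; first by rewrite subr_ge0.
  have : 0 <= N * (b - s - 2 * a ^+ 3 * m).
    by rewrite mulr_ge0 // ?ltW //; lra.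
  have : 0 <= N * s by rewrite mulr_ge0 // ltW.
  have : 0 <= a ^+ 3 * (m * N - 1) by rewrite mulr_ge0 ?subr_ge0 // ltW.
  by lra.
have : 0 < N ^+ 2 * (a ^+ 3 * m ^+ 2 - b * m + alpha).
  by rewrite mulr_gt0 ?exprn_gt0.
have : 0 <= a * (N - a ^+ 2) by rewrite mulr_ge0 ?subr_ge0 // ltW.
by rewrite /b; lra.
Qed.

(* [p] is the inner product of two vectors orthogonal to [zeta], of squared
   norms [N - a^2] and [dd - delta^2]. *)
Lemma local_quadratic_bound a N m al at_ dd delta p tau t :
  0 < a -> 0 < m -> 0 < t -> 0 <= delta -> 0 <= dd - delta ^+ 2 ->
  0 < at_ -> at_ / 2 * dd <= delta -> 0 <= al ->
  p ^+ 2 <= (N - a ^+ 2) * (dd - delta ^+ 2) ->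
  m * N < 1 -> m ^+ 2 * (N - a ^+ 2) <= (1 - m * N) * (al / a - m) ->
  al * t / at_ + a * m / 2 * (t * delta - 2 * tau * a) <= 1 ->
  m * (tau ^+ 2 * N + 2 * tau * t * (p - a * delta) + t ^+ 2 * dd)
    <= tau ^+ 2 + 2 * t * delta / a.
Proof.
move=> a0 m0 t0 de0 F0 at0 dd_le al0 pCS mN mW small.
set F := dd - delta ^+ 2 in F0 pCS.
(* Multiplying by [1 - m * N] completes the square in [tau]; what remains is nonnegative by
   Cauchy-Schwarz ([pCS]) and the discriminant condition on [m]. *)
have quad : 0 <= (1 - m * N) * tau ^+ 2 - 2 * m * tau * t * p
    + (al / a - m) * t ^+ 2 * F.
  rewrite -(@pmulr_rge0 _ (1 - m * N)) ?subr_gt0 //.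
  have h1 : m ^+ 2 * p ^+ 2 <= (1 - m * N) * (al / a - m) * F.
    apply: (@le_trans _ _ (m ^+ 2 * ((N - a ^+ 2) * F))).
      by rewrite ler_wpM2l ?sqr_ge0.
    by rewrite mulrA ler_wpM2r.
  have h2 : 0 <= t ^+ 2 * ((1 - m * N) * (al / a - m) * F - m ^+ 2 * p ^+ 2).
    by rewrite mulr_ge0 ?sqr_ge0 ?subr_ge0.
  have := sqr_ge0 ((1 - m * N) * tau - m * t * p).
  move: (al / a) h1 h2 => q h1 h2; lra.
(* The curvature gain on the right pays for the term that [quad] consumes and for the terms from the
   [zeta] component; [small] says that the fraction spent is at most 1. *)
have rest : al / a * t ^+ 2 * F + m * t * delta * (t * delta - 2 * tau * a)
   <= 2 * t * delta / a.
  have FD : F <= 2 * delta / at_.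
    rewrite ler_pdivlMr //; have := sqr_ge0 delta; rewrite /F => h.
    have : 0 <= at_ * delta ^+ 2 by rewrite mulr_ge0 // ltW.
    lra.
  have h1 : al / a * t ^+ 2 * F <= al / a * t ^+ 2 * (2 * delta / at_).
    by rewrite ler_wpM2l // mulr_ge0 ?sqr_ge0 ?divr_ge0 // ltW.
  have h2 : 2 * t * delta / a *
    (al * t / at_ + a * m / 2 * (t * delta - 2 * tau * a)) <= 2 * t * delta / a.
    by rewrite ler_piMr // divr_ge0 ?mulr_ge0 // ltW.
  have h3 : 2 * t * delta / a *
      (al * t / at_ + a * m / 2 * (t * delta - 2 * tau * a)) =
    al / a * t ^+ 2 * (2 * delta / at_)
      + m * t * delta * (t * delta - 2 * tau * a).
    by field; rewrite !gt_eqF.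
  lra.
rewrite /F in quad rest.
move: quad rest; set q := al / a; set q' := 2 * t * delta / a => quad rest.
lra.
Qed.

End StrongConvexityArithmetic.

(** * Calculus of the gauge of a convex set containing a ball around 0 *)

Section Gauge.
Context {R : realType} {n : nat}.
Variables (S : set 'cV[R]_n) (r : R).
Hypothesis r_gt0 : 0 < r.
Hypothesis ball_S : forall x, enorm x < r -> S x.
Hypothesis S_convex : convex_set S.
Implicit Types (x y z g : 'cV[R]_n) (k l t : R).

Lemma gauge_le x l : 0 < l -> S (l^-1 *: x) -> gauge S x <= l.
Proof.
move=> l0 Sx; apply: ge_inf; first by exists 0 => k [/ltW].
by split => //; exists (l^-1 *: x); rewrite // scalerA divff ?scale1r ?gt_eqF.
Qed.

Lemma gauge_set_nonempty x :
  [set l : R | 0 < l /\ ((fun s => l *: s) @` S) x] !=set0.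
Proof.
have l0 : 0 < enorm x / r + 1 by rewrite ltr_wpDl // divr_ge0 ?enorm_ge0 // ltW.
exists (enorm x / r + 1); split=> //.
exists ((enorm x / r + 1)^-1 *: x); last first.
  by rewrite scalerA divff ?scale1r ?gt_eqF.
apply: ball_S; rewrite enormZ gtr0_norm ?invr_gt0 // mulrC ltr_pdivrMr //.
by rewrite mulrDr mulr1 mulrCA divff ?gt_eqF // mulr1 ltrDl.
Qed.

Lemma le_gauge x k :
  (forall l, 0 < l -> S (l^-1 *: x) -> k <= l) -> k <= gauge S x.
Proof.
move=> kl; apply: lb_le_inf; first exact: gauge_set_nonempty.
move=> l [l0 [s Ss sx]]; apply: kl => //.
by rewrite -sx scalerA mulVf ?scale1r ?gt_eqF.
Qed.

Lemma gauge_ge0 x : 0 <= gauge S x.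
Proof. by apply: le_gauge => l /ltW. Qed.

Lemma convex_comb_mem x y t : 0 <= t -> t <= 1 -> S x -> S y ->
  S (t *: x + (1 - t) *: y).
Proof.
move=> t0 t1 Sx Sy.
have := S_convex (Itv01 t0 t1) (mem_set Sx) (mem_set Sy).
by rewrite inE.
Qed.

Lemma gauge_lt_mem x l : gauge S x < l -> S (l^-1 *: x).
Proof.
move=> xl; have [k [k0 [s Ss <-]] kl] := inf_lt (gauge_set_nonempty x) xl.
have l0 : 0 < l by exact: lt_trans kl.
(* The point lies on the segment from 0 to [s], since [k < l]. *)
have -> : l^-1 *: (k *: s) = (k / l) *: s + (1 - k / l) *: 0.
  by rewrite scaler0 addr0 scalerA mulrC.
apply: convex_comb_mem => //; first by rewrite divr_ge0 // ltW.
  by rewrite ler_pdivrMr // mul1r ltW.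
by apply: ball_S; rewrite enorm0.
Qed.

(** If [x / k] and [y / l] lie in [S], their convex combination with weights proportional to [k] and
    [l] is [(x + y) / (k + l)]. *)
Lemma gaugeD x y : gauge S (x + y) <= gauge S x + gauge S y.
Proof.
apply/ler_addgt0Pr => e e0.
set k := gauge S x + e / 2; set l := gauge S y + e / 2.
have k0 : 0 < k by rewrite ltr_wpDl ?gauge_ge0 // divr_gt0.
have l0 : 0 < l by rewrite ltr_wpDl ?gauge_ge0 // divr_gt0.
have kl0 : 0 < k + l by rewrite addr_gt0.
have -> : gauge S x + gauge S y + e = k + l by rewrite /k /l; lra.
apply: gauge_le => //.
have Sx : S (k^-1 *: x) by apply: gauge_lt_mem; rewrite ltrDl divr_gt0.
have Sy : S (l^-1 *: y) by apply: gauge_lt_mem; rewrite ltrDl divr_gt0.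
have -> : (k + l)^-1 *: (x + y) =
    (k / (k + l)) *: (k^-1 *: x) + (1 - k / (k + l)) *: (l^-1 *: y).
  rewrite scalerDr !scalerA; congr (_ *: _ + _ *: _).
    by field; rewrite !gt_eqF.
  by field; rewrite !gt_eqF.
apply: convex_comb_mem => //; first by rewrite divr_ge0 // ltW.
by rewrite ler_pdivrMr // mul1r lerDl ltW.
Qed.

Lemma gauge0 : gauge S 0 = 0.
Proof.
apply/eqP; rewrite eq_le gauge_ge0 andbT; apply/ler_addgt0Pr => e e0.
by rewrite add0r gauge_le // scaler0; apply: ball_S; rewrite enorm0.
Qed.

Lemma gaugeZ_le k x : 0 < k -> gauge S (k *: x) <= k * gauge S x.
Proof.
move=> k0; rewrite mulrC -ler_pdivrMr //; apply: le_gauge => l l0 Sl.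
rewrite ler_pdivrMr // gauge_le ?mulr_gt0 //.
by rewrite scalerA invfM mulrVK ?unitfE ?gt_eqF.
Qed.

Lemma gaugeZ k x : 0 <= k -> gauge S (k *: x) = k * gauge S x.
Proof.
rewrite le_eqVlt => /predU1P[<-|k0]; first by rewrite scale0r gauge0 mul0r.
apply/eqP; rewrite eq_le gaugeZ_le //=.
rewrite mulrC -ler_pdivlMr // mulrC.
rewrite -[X in gauge S X <= _](scalerK (lt0r_neq0 k0)).
by rewrite gaugeZ_le ?invr_gt0.
Qed.

Lemma gauge_le_enorm x : gauge S x <= enorm x / r.
Proof.
apply/ler_addgt0Pr => e e0.
have l0 : 0 < enorm x / r + e.
  by rewrite ltr_wpDl // divr_ge0 ?enorm_ge0 // ltW.
apply: gauge_le => //.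
apply: ball_S; rewrite enormZ gtr0_norm ?invr_gt0 // mulrC ltr_pdivrMr //.
by rewrite mulrDr mulrCA divff ?gt_eqF // mulr1 ltrDl mulr_gt0.
Qed.

Lemma gauge_lipschitz x y : `|gauge S x - gauge S y| <= enorm (x - y) / r.
Proof.
rewrite ler_norml; apply/andP; split.
  have := gaugeD x (y - x); rewrite addrC subrK => h1.
  have := gauge_le_enorm (y - x); rewrite -enormN opprB => h2; lra.
have := gaugeD y (x - y); rewrite addrC subrK => h1.
by have := gauge_le_enorm (x - y) => h2; lra.
Qed.

(** The infimum is attained: [l^-1 *: x] is in [S] for every [l] above the gauge, and closedness
    permits letting [l] decrease to it. *)
Lemma gauge_mem x : closed S -> 0 < gauge S x -> S ((gauge S x)^-1 *: x).
Proof.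
move=> S_closed x0.
apply: (@closed_cvg _ _ (gauge S x)^'+ _ (fun l => l^-1 *: x) S) => //.
  near=> l; apply: gauge_lt_mem; near: l; exact: nbhs_right_gt.
apply: cvgZr_tmp; apply: cvgV; first by rewrite gt_eqF.
by apply: cvg_at_right_filter; exact: cvg_id.
Unshelve. all: by end_near. Qed.

Lemma half_sq_gauge_ge0 x : 0 <= half_sq_gauge S x.
Proof. by rewrite mulr_ge0 ?invr_ge0 ?sqr_ge0. Qed.

(** * Continuity and convexity of the half squared gauge *)

Lemma gauge_continuous : continuous (gauge S).
Proof.
move=> x; apply: (@cvgrPdist_lt _ _ _ (nbhs x) _ _ _).2 => e e0.
have d0 : 0 < e / 2 * r / n.+1%:R by rewrite !(mulr_gt0, divr_gt0, invr_gt0).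
apply/nbhs_ballP; exists (e / 2 * r / n.+1%:R) => //= y [_ xy].
apply: le_lt_trans (gauge_lipschitz x y) _.
apply: (@le_lt_trans _ _ (e / 2)); last by lra.
rewrite ler_pdivrMr // -[X in _ <= X](mulfVK (_ : n.+1%:R != 0)) // mulrC.
apply: enorm_le_coord; first exact: ltW.
by move=> i; rewrite !mxE ltW //; exact: xy.
Qed.

Lemma half_sq_gauge_closed_convex : closed_convex_function (half_sq_gauge S).
Proof.
split.
  move=> t x y _ _.
  have t0 : 0 <= t%:num by [].
  have t1 : t%:num <= 1 by [].
  suff : half_sq_gauge S (t%:num *: x + (1 - t%:num) *: y) <=
    t%:num * half_sq_gauge S x + (1 - t%:num) * half_sq_gauge S y by [].
  have {t0 t1} : 0 <= t%:num <= 1 by rewrite t0 t1.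
  move: (t%:num) => {}t /andP[t0 t1]; rewrite /half_sq_gauge.
  have := gaugeD (t *: x) ((1 - t) *: y).
  rewrite !gaugeZ ?subr_ge0 //; have := gauge_ge0 (t *: x + (1 - t) *: y).
  move: (gauge S (_ + _)) (gauge S x) (gauge S y) => u p q u0 upq.
  (* Squaring preserves the sublinear bound because gauges are nonnegative; the convexity gap of the
     square is [t * (1 - t) * (p - q) ^+ 2]. *)
  have : u ^+ 2 <= (t * p + (1 - t) * q) ^+ 2.
    by rewrite ler_sqr ?nnegrE // (le_trans u0).
  have : 0 <= t * (1 - t) * (p - q) ^+ 2.
    by apply: mulr_ge0; rewrite ?sqr_ge0 // mulr_ge0 ?subr_ge0.
  by lra.
move=> x a; rewrite lte_fin => ax.
exists [set z | a < half_sq_gauge S z] => //.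
have : half_sq_gauge S z @[z --> x] --> half_sq_gauge S x.
  have gx : gauge S z @[z --> x] --> gauge S x by exact: gauge_continuous.
  exact: cvgM (cvg_cst _) (cvgM gx gx).
by move/cvgr_gt; apply.
Qed.

(** * Points of gauge zero: the origin and recession directions *)

Lemma subdifferential_half_sq_gauge0 :
  subdifferential (half_sq_gauge S) 0 = [set 0].
Proof.
have h0 : half_sq_gauge S 0 = 0 by rewrite /half_sq_gauge gauge0 expr0n mulr0.
apply/seteqP; split=> [g gsub|_ -> z]; last first.
  by rewrite dot0l h0 subr0 half_sq_gauge_ge0.
apply: dot_eq0; apply/eqP; rewrite eq_le dot_ge0 andbT leNgt; apply/negP => g0.
(* At [r ^+ 2 *: g] the linear term is [r ^+ 2 * dot g g], while the bound of the gauge by the norm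
   over [r] caps the function at half of that. *)
have := gsub (r ^+ 2 *: g); rewrite h0 !subr0 dotZr /half_sq_gauge => gr.
have : gauge S (r ^+ 2 *: g) ^+ 2 <= (enorm (r ^+ 2 *: g) / r) ^+ 2.
  have h := gauge_le_enorm (r ^+ 2 *: g).
  by rewrite ler_sqr ?nnegrE ?gauge_ge0 // (le_trans (gauge_ge0 _) h).
rewrite exprMn enorm_sqr !dot_lin exprVn => h.
have h2 : r ^+ 2 * (r ^+ 2 * dot g g) / r ^+ 2 = r ^+ 2 * dot g g.
  by field; rewrite gt_eqF.
have : 0 < r ^+ 2 * dot g g by rewrite mulr_gt0 ?exprn_gt0.
by rewrite h2 in h; lra.
Qed.

(** If [z / l] is in [S] then [enorm z <= l * D(S)], so the gauge dominates the norm over [D(S)].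
    The bound is global, hence the arbitrary radius 1. *)
Lemma strongly_convex_half_sq_gauge0 :
  strongly_convex_function_at (half_sq_gauge S)
    (fine (outer_radius S)^-1%E ^+ 2) 0 0.
Proof.
set M := fine _ => m mM; exists 1 => // z _.
have h0 : half_sq_gauge S 0 = 0 by rewrite /half_sq_gauge gauge0 expr0n mulr0.
rewrite subr0 dot0l h0 !add0r /half_sq_gauge.
have M0 s : S s -> 0 <= M /\ enorm s * M <= 1.
  move=> Ss; rewrite /M.
  have : ((enorm s)%:E <= outer_radius S)%E.
    by apply: ereal_sup_ubound; exists s.
  have := enorm_ge0 s.
  (* [M] is 0 both for an unbounded [S] and for [D(S) = 0]; the latter means that the space is
     trivial. *)
  case: (outer_radius S) => [D| |] //=; last by rewrite /inve /= mulr0.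
  rewrite lee_fin /inve; case: eqP => [_|/eqP D0] /= s0 sD.
    by rewrite mulr0.
  have {}D0 : 0 < D by rewrite lt_neqAle eq_sym D0 (le_trans s0).
  by rewrite ler_pdivrMr // mul1r invr_ge0 ltW.
have S0 : S 0 by apply: ball_S; rewrite enorm0.
have Mge0 : 0 <= M by case: (M0 _ S0).
have zM : enorm z * M <= gauge S z.
  apply: le_gauge => l l0 /M0[_].
  by rewrite enormZ gtr0_norm ?invr_gt0 // -mulrA mulrC ler_pdivrMr // mul1r.
have : (enorm z * M) ^+ 2 <= gauge S z ^+ 2.
  by rewrite ler_sqr ?nnegrE ?gauge_ge0 ?mulr_ge0 ?enorm_ge0.
have : 0 <= (M ^+ 2 - m) * enorm z ^+ 2.
  by rewrite mulr_ge0 ?sqr_ge0 // subr_ge0 ltW.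
by lra.
Qed.

(* Along the ray through [y] the function vanishes, so no quadratic lower bound
   can hold on both sides of [y]. *)
Lemma half_sq_gauge_not_strongly_convex y :
  gauge S y = 0 -> y <> 0 -> not_strongly_convex_function_at (half_sq_gauge S) y.
Proof.
move=> gy y0 mu g mu0 _ /(_ (mu / 2)) [|eta eta0 sc]; first by lra.
have yy0 : 0 < dot y y.
  by rewrite lt_neqAle dot_ge0 andbT eq_sym; apply/eqP => /dot_eq0.
have ey0 : 0 < enorm y by rewrite sqrtr_gt0.
(* The cap 1 keeps [1 - e] nonnegative, so that both test points stay on the ray; the other bound
   keeps them within [eta] of [y]. *)
set e := Num.min 1 (eta / enorm y).
have e0 : 0 < e by rewrite lt_min ltr01 divr_gt0.
have e1 : e <= 1 by rewrite ge_min lexx.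
have hk k : 0 <= k -> half_sq_gauge S (k *: y) = 0.
  by move=> k0; rewrite /half_sq_gauge gaugeZ // gy mulr0 expr0n mulr0.
have hy : half_sq_gauge S y = 0 by rewrite -[y]scale1r hk.
have ineq k : `|k| = e -> k * dot g y + mu / 2 / 2 * (e ^+ 2 * dot y y) <= 0.
  move=> ke.
  have := sc ((1 + k) *: y); rewrite /eball /=.
  have -> : (1 + k) *: y - y = k *: y by rewrite scalerDl scale1r addrC addKr.
  rewrite enormZ ke -ler_pdivlMr // ge_min lexx orbT => /(_ isT).
  rewrite hy hk ?add0r ?dotZr ?exprMn ?enorm_sqr //.
  by have := ler_norm (- k); rewrite normrN ke; lra.
(* Adding the inequalities for [e] and [- e] cancels the linear term. *)
have := ineq e (gtr0_norm e0); have := ineq (- e).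
rewrite normrN gtr0_norm // => /(_ erefl).
have : 0 < mu * (e ^+ 2 * dot y y) by rewrite !mulr_gt0 ?exprn_gt0.
by lra.
Qed.

(** * Unit normals and the subgradients they induce *)

Section NormalVector.
Variables x zeta : 'cV[R]_n.
Hypothesis zeta_unit : enorm zeta = 1.
Hypothesis zeta_normal : normal_cone S x zeta.

Let zz1 : dot zeta zeta = 1.
Proof. by rewrite -enorm_sqr zeta_unit expr1n. Qed.

(** The point [(r / 2) *: zeta] of [S] already has inner product [r / 2] with [zeta], and [x]
    maximises this product over [S]. *)
Lemma normal_dot_gt0 : 0 < dot zeta x.
Proof.
have : S ((r / 2) *: zeta).
  by apply: ball_S; rewrite enormZ zeta_unit mulr1 gtr0_norm; move: r_gt0; lra.
by move=> /zeta_normal; rewrite !dot_lin zz1; move: r_gt0; lra.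
Qed.

Lemma normal_dot_le_gauge z : dot zeta z <= dot zeta x * gauge S z.
Proof.
rewrite mulrC -ler_pdivrMr ?normal_dot_gt0 //; apply: le_gauge => l l0.
move=> /zeta_normal; rewrite !dot_lin subr_le0 mulrC ler_pdivrMr //.
by rewrite ler_pdivrMr ?normal_dot_gt0 // mulrC.
Qed.

End NormalVector.

(** The linear minorant of the gauge given by the normal is exact at [y]; it is combined with the
    tangent line of half the square at [gauge S y]. *)
Lemma normal_subdifferential y zeta :
  0 < gauge S y -> enorm zeta = 1 -> normal_cone S ((gauge S y)^-1 *: y) zeta ->
  subdifferential (half_sq_gauge S) y
    ((gauge S y / dot zeta ((gauge S y)^-1 *: y)) *: zeta).
Proof.
move=> c0 z1 zN z; have a0 := normal_dot_gt0 z1 zN.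
have := normal_dot_le_gauge z1 zN z.
rewrite /half_sq_gauge in a0 *; rewrite !dot_lin in a0 *.
move: (gauge S z) (dot zeta y) (dot zeta z) a0 => q v w a0 h.
move: (gauge S y) c0 a0 h => c c0 a0 h.
have v0 : 0 < v by move: a0; rewrite pmulr_rgt0 ?invr_gt0.
have -> : c / (c^-1 * v) * (w + - v) = c * (c * w / v - c).
  by field; rewrite !gt_eqF.
have {h} : c * w / v <= q.
  by rewrite ler_pdivrMr // -ler_pdivlMl // [q * v]mulrC mulrA.
move: (c * w / v) => u uq.
have : c * u <= c * q by rewrite ler_pM2l.
by have := sqr_ge0 (q - c); lra.
Qed.

(** * Strong convexity at points of positive gauge *)

(** Brings the normalised point into the ball where the curvature hypothesis applies, with gauge
    ratio near 1. The cap on [rho] keeps [gauge S z] at least half of [gauge S y]. *)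
Lemma radial_projection_continuous y (rho : R) :
  0 < gauge S y -> 0 < rho -> rho <= 2^-1 ->
  exists2 e : R, 0 < e & forall z, enorm (z - y) <= e ->
    [/\ 0 < gauge S z, `|gauge S z / gauge S y - 1| <= rho
      & enorm ((gauge S z)^-1 *: z - (gauge S y)^-1 *: y) <= rho].
Proof.
set c := gauge S y => c0 rho0 rho_half.
(* A Lipschitz constant for normalisation at [y]: [2 / c] bounds the inverse gauge, and the other
   factor bounds the displacement plus the rescaling error. *)
set L := 2 / c * (1 + enorm y / (r * c)).
have L0 : 0 < L.
  have : 0 <= enorm y / (r * c) by rewrite divr_ge0 ?enorm_ge0 // ltW ?mulr_gt0.
  by move=> h; rewrite mulr_gt0 ?divr_gt0 //; lra.
have q0 : 0 < (r * c)^-1 + L by rewrite addr_gt0 // invr_gt0 mulr_gt0.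
exists (rho / ((r * c)^-1 + L)) => [|z]; first by rewrite divr_gt0.
rewrite ler_pdivlMr // => zy.
have := enorm_ge0 (z - y); set u := enorm (z - y) in zy * => u0.
have ur : u / (r * c) <= rho.
  by apply: le_trans zy; rewrite ler_wpM2l // lerDl ltW.
have uL : u * L <= rho.
  by apply: le_trans zy; rewrite ler_wpM2l // lerDr invr_ge0 ltW ?mulr_gt0.
have zc : `|gauge S z / c - 1| <= u / (r * c).
  have -> : gauge S z / c - 1 = (gauge S z - c) / c by field; rewrite gt_eqF.
  rewrite normrM (gtr0_norm (_ : 0 < c^-1)) ?invr_gt0 // invfM mulrA.
  by rewrite ler_pM2r ?invr_gt0 // gauge_lipschitz.
have half : 2^-1 <= gauge S z / c.
  by have := le_trans zc ur; rewrite ler_norml => /andP[]; lra.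
have z0 : 0 < gauge S z.
  by move: half; rewrite ler_pdivlMr //; move: c0; lra.
split=> //; first exact: le_trans ur.
have -> : (gauge S z)^-1 *: z - c^-1 *: y =
    (gauge S z)^-1 *: ((z - y) + (1 - gauge S z / c) *: y).
  rewrite scalerDr scalerA mulrBr mulr1 mulKf ?gt_eqF //.
  by rewrite scalerBr scalerBl addrA subrK.
apply: le_trans uL; rewrite enormZ gtr0_norm ?invr_gt0 //.
have zV : (gauge S z)^-1 <= 2 / c.
  rewrite -[2]invrK -invfM lef_pV2 ?posrE ?mulr_gt0 ?invr_gt0 //.
  by rewrite -ler_pdivlMr.
have h : enorm (z - y + (1 - gauge S z / c) *: y) <=
    u * (1 + enorm y / (r * c)).
  apply: (le_trans (ler_enormD _ _)); rewrite mulrDr mulr1 lerD2l enormZ.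
  by rewrite distrC mulrCA [X in X <= _]mulrC ler_wpM2l ?enorm_ge0.
rewrite /L mulrCA; apply: ler_pM => //; last exact: enorm_ge0.
by rewrite invr_ge0 ltW.
Qed.

(** With [d = s - xbar], expanding the ball condition cancels [e^-1 ^+ 2] and leaves
    [dot d d + 2 / e * dot zeta d <= 0]. *)
Lemma dot_le_of_mem_tangent_ball (xbar zeta s : 'cV[R]_n) (e : R) :
  dot zeta zeta = 1 -> 0 < e ->
  enorm (s - (xbar - e^-1 *: zeta)) <= e^-1 ->
  e / 2 * dot (s - xbar) (s - xbar) <= - dot zeta (s - xbar).
Proof.
move=> z1 e0.
have -> : s - (xbar - e^-1 *: zeta) = s - xbar + e^-1 *: zeta.
  by rewrite opprB addrCA addrC.
move: (s - xbar) => d de.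
have : enorm (d + e^-1 *: zeta) ^+ 2 <= e^-1 ^+ 2.
  by rewrite ler_sqr ?nnegrE ?enorm_ge0 ?invr_ge0 // ltW.
rewrite enorm_sqr !dot_lin z1 (dotC d) => h.
have : dot d d + 2 / e * dot zeta d <= 0 by move: h; move: (e^-1) => q; lra.
have -> : 2 / e * dot zeta d = 2 * dot zeta d / e by rewrite mulrAC.
rewrite -(pmulr_rle0 _ e0) mulrDr [e * (_ / e)]mulrC divfK ?gt_eqF //; lra.
Qed.

Lemma strongly_convex_half_sq_gauge alpha y zeta :
  closed S -> 0 < alpha -> 0 < gauge S y ->
  let ybar := (gauge S y)^-1 *: y in
  enorm zeta = 1 -> normal_cone S ybar zeta ->
  strongly_convex_set_at S alpha ybar zeta ->
  let a := dot zeta ybar in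
  let b := a + alpha * enorm ybar ^+ 2 in
  strongly_convex_function_at (half_sq_gauge S)
    ((2 * a ^+ 3)^-1 * (b - Num.sqrt (b ^+ 2 - 4 * alpha * a ^+ 3)))
    y ((gauge S y / a) *: zeta).
Proof.
move=> S_closed al0 c0 ybar z1 zN sc a b m mmu.
have gsub := normal_subdifferential c0 z1 zN; rewrite -/ybar -/a in gsub.
have a0 : 0 < a := normal_dot_gt0 z1 zN.
have zz1 : dot zeta zeta = 1 by rewrite -enorm_sqr z1 expr1n.
(* For [m <= 0] the subgradient inequality suffices. *)
have [m0|m0] := leP m 0.
  exists 1 => // z _; have := gsub z.
  have : 0 <= - m * enorm (z - y) ^+ 2 by rewrite mulr_ge0 ?oppr_ge0 ?sqr_ge0.
  by lra.
set N := enorm ybar ^+ 2 in b mmu.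
have NE : N = dot ybar ybar by rewrite /N enorm_sqr.
have aN : a ^+ 2 <= N.
  by have := dot_cauchy_schwarz zeta ybar; rewrite zz1 mul1r NE.
have [mN P0] := modulus_root a0 al0 aN mmu.
have mN' : 0 < 1 - m * N by rewrite subr_gt0.
(* [q] turns the discriminant condition [mW] into an equality, so [al1] is the curvature that
   modulus [m] requires; [al1 < alpha] is then exactly positivity of the quadratic at [m]. *)
set q := m ^+ 2 * (N - a ^+ 2) / (1 - m * N).
have q0 : 0 <= q by rewrite divr_ge0 ?mulr_ge0 ?sqr_ge0 ?subr_ge0 // ltW.
set al1 := a * (m + q).
have al10 : 0 < al1 by rewrite mulr_gt0 // ltr_wpDr.
have al1_lt : al1 < alpha.
  rewrite -(ltr_pM2l mN') -subr_gt0.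
  have -> : (1 - m * N) * alpha - (1 - m * N) * al1 =
      a ^+ 3 * m ^+ 2 - b * m + alpha.
    by rewrite /al1 /q /b; field; rewrite gt_eqF.
  by [].
have mW : m ^+ 2 * (N - a ^+ 2) <= (1 - m * N) * (al1 / a - m).
  rewrite /al1 /q le_eqVlt; apply/orP; left; apply/eqP.
  by field; rewrite !gt_eqF.
(* Curvature strictly between the required and the available one leaves the slack [1 - al1 / at_]
   for the error terms. *)
set at_ := (al1 + alpha) / 2.
have at0 : 0 < at_ by rewrite /at_; lra.
have [eta eta0 sc_eta] := sc at_ at0 ltac:(rewrite /at_; lra).
have k1 : al1 / at_ < 1 by rewrite ltr_pdivrMr // mul1r /at_; lra.
(* When [t - 1] and [delta] are bounded by [rho], the left side of [small] is at most
   [al1 / at_ + rho * K]. *)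
set K := al1 / at_ + a * m * (1 + a).
have K0 : 0 < K.
  have : 0 < a * m * (1 + a) by rewrite mulr_gt0 ?mulr_gt0 // addr_gt0.
  by move=> am; rewrite addr_gt0 ?(divr_gt0 al10 at0).
set rho := Num.min (Num.min ((1 - al1 / at_) / K) eta) 2^-1.
have rho0 : 0 < rho 
  by rewrite !lt_min eta0 invr_gt0 ltr0n !andbT divr_gt0 // subr_gt0.
have rho_half : rho <= 2^-1 by rewrite ge_min lexx orbT.
have rho_eta : rho <= eta by rewrite !ge_min lexx !orbT.
have rhoK : rho * K <= 1 - al1 / at_.
  by rewrite -ler_pdivlMr // !ge_min lexx.
have [e e0 proj] := radial_projection_continuous c0 rho0 rho_half.
exists e => // z /proj[z0 tau_le d_le].
have Ss := gauge_mem S_closed z0.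
rewrite -/ybar in d_le.
set s := (gauge S z)^-1 *: z in Ss d_le.
have [|sball _] := sc_eta s; first by split=> //; exact: le_trans rho_eta.
have curv := dot_le_of_mem_tangent_ball zz1 at0 sball.
set d := s - ybar in d_le curv.
have [delta zd] : exists delta, dot zeta d = - delta.
  by exists (- dot zeta d); rewrite opprK.
rewrite zd opprK in curv.
set t := gauge S z / gauge S y in tau_le.
have gz : gauge S z = gauge S y * t by rewrite /t mulrC divfK ?gt_eqF.
have zE : z - y = gauge S y *: ((t - 1) *: ybar + t *: d).
  have -> : (t - 1) *: ybar + t *: d = t *: s - ybar.
    by rewrite /d scalerBr scalerBl scale1r addrC addrA subrK.
  rewrite scalerBr !scalerA -gz divff ?gt_eqF // divff ?gt_eqF //.
  by rewrite !scale1r.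
have t0 : 0 < t by rewrite divr_gt0.
clearbody d t ybar.
have dlt0 : 0 <= delta.
  by apply: le_trans curv; rewrite mulr_ge0 ?dot_ge0 // divr_ge0 // ltW.
have dlt_rho : delta <= rho.
  apply: le_trans d_le; have := normr_dot_le zeta d; rewrite z1 mul1r.
  by apply: le_trans; rewrite zd normrN ler_norm.
have F0 : 0 <= dot d d - delta ^+ 2.
  have := dot_cauchy_schwarz zeta d.
  by rewrite zz1 mul1r subr_ge0 zd sqrrN.
(* Cauchy-Schwarz for the components of [ybar] and [d] orthogonal to [zeta]. *)
have pCS : (dot ybar d + a * delta) ^+ 2 <=
    (N - a ^+ 2) * (dot d d - delta ^+ 2).
  have := dot_cauchy_schwarz (ybar - a *: zeta) (d + delta *: zeta).
  rewrite !dot_lin zz1 !(dotC _ zeta) -/a.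
  rewrite zd -NE; congr (_ <= _); ring.
have small : al1 * t / at_ + a * m / 2 * (t * delta - 2 * (t - 1) * a) <= 1.
  move: tau_le; rewrite ler_norml => /andP[tl tu].
  have -> : al1 * t / at_ = al1 / at_ * t by rewrite mulrAC.
  have h1 : al1 / at_ * t <= al1 / at_ * (1 + rho).
    by rewrite ler_wpM2l ?(ltW (divr_gt0 al10 at0)) //; lra.
  have h2 : t * delta <= 2 * rho.
    by apply: ler_pM => //; [exact: ltW|lra].
  have h3 : 0 <= a * (t - 1 + rho) by rewrite mulr_ge0 ?(ltW a0) //; lra.
  have h4 : a * m / 2 * (t * delta - 2 * (t - 1) * a) <=
      a * m / 2 * (2 * rho + 2 * a * rho).
    by rewrite ler_wpM2l ?divr_ge0 ?mulr_ge0 ?(ltW a0) ?(ltW m0) //; lra.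
  move: rhoK; rewrite /K; move: h1 h4.
  by move: (al1 / at_) => k; lra.
have main := local_quadratic_bound a0 m0 t0 dlt0 F0 at0 curv (ltW al10) pCS mN
  mW small.
have zetaz : dot zeta (z - y) = gauge S y * ((t - 1) * a - t * delta).
  by rewrite zE !dot_lin -/a zd mulrN.
have nz : enorm (z - y) ^+ 2 = gauge S y ^+ 2 * ((t - 1) ^+ 2 * N +
    2 * (t - 1) * t * (dot ybar d + a * delta - a * delta) + t ^+ 2 * dot d d).
  by rewrite enorm_sqr zE !dot_lin (dotC d ybar) NE; ring.
rewrite nz dotZl zetaz /half_sq_gauge gz.
move: main; set X := (t - 1) ^+ 2 * N + _ + _ => main.
(* Since [t ^+ 2 = 1 + 2 * (t - 1) + (t - 1) ^+ 2], the goal becomes [main] times half of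
   [gauge S y ^+ 2]. *)
have -> : gauge S y / a * (gauge S y * ((t - 1) * a - t * delta)) =
    gauge S y ^+ 2 * ((t - 1) - (2 * t * delta / a) / 2).
  by field; rewrite gt_eqF.
have := ler_wpM2l (sqr_ge0 (gauge S y)) main.
by move: (2 * t * delta / a) => v; lra.
Qed.

End Gauge.

Theorem theorem11 (R : realType) (n : nat) (alpha : R) (y : 'cV[R]_n)
    (S : set 'cV[R]_n)
    (alpha_gt0 : 0 < alpha)
    (S_closed : closed S)
    (S_convex : convex_set S)
    (S_int0 : interior S 0) :
  [/\ closed_convex_function (half_sq_gauge S),
      gauge S y != 0 ->
      let ybar := (gauge S y)^-1 *: y in
      forall zeta : 'cV[R]_n,
      enorm zeta = 1 ->
      normal_cone S ybar zeta ->
      strongly_convex_set_at S alpha ybar zeta ->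
      let a := dot zeta ybar in
      let b := a + alpha * enorm ybar ^+ 2 in
      let mu := (2 * a ^+ 3)^-1 *
                (b - Num.sqrt (b ^+ 2 - 4 * alpha * a ^+ 3)) in
      let g := (gauge S y / a) *: zeta in
      subdifferential (half_sq_gauge S) y g /\
      strongly_convex_function_at (half_sq_gauge S) mu y g,
      gauge S y = 0 -> y = 0 ->
      subdifferential (half_sq_gauge S) y = [set 0] /\
      strongly_convex_function_at (half_sq_gauge S)
        (fine (outer_radius S)^-1%E ^+ 2) 0 0
    & gauge S y = 0 -> y <> 0 ->
      not_strongly_convex_function_at (half_sq_gauge S) y].
Proof.
have [r r0 ball_S'] := nbhs_eball S_int0.
have ball_S x : enorm x < r -> S x.
  by move=> xr; apply: ball_S'; rewrite subr0.
split.
- exact (half_sq_gauge_closed_convex r0 ball_S S_convex).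
- move=> c_neq0 ybar zeta z1 zN sc a b mu g.
  have c0 : 0 < gauge S y.
    by rewrite lt_neqAle eq_sym c_neq0 (gauge_ge0 r0 ball_S).
  split; first exact (normal_subdifferential r0 ball_S c0 z1 zN).
  exact (strongly_convex_half_sq_gauge r0 ball_S S_convex S_closed alpha_gt0 c0
    z1 zN sc).
- move=> _ ->; split; first exact: subdifferential_half_sq_gauge0 r0 ball_S.
  exact (strongly_convex_half_sq_gauge0 r0 ball_S).
- exact (half_sq_gauge_not_strongly_convex r0 ball_S (y := y)).
Qed.
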